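(* Let $a$ and $b$ be positive integers such that $\gcd(a,b)=1$. Let $p(z)=a_Dz^D+\dots+a_1z\in \mathbb{Z}[z]$ (with zero constant term) satisfy $D\ge 2$, $a_D>0$ and $a_1\neq 0$. Then the equation $ax+by=p(z)$ is 2-Ramsey.
   Context: For $k\in\mathbb{Z}^+$, an equation in the variables $x,y,z$ is called $k$-Ramsey if every colouring of the positive integers $\mathbb{Z}^+$ with $k$ colours admits infinitely many monochromatic solutions $(x,y,z)\in(\mathbb{Z}^+)^3$, i.e. solutions with $x,y,z$ all receiving the same colour. *)

(* Defs.v *)
From mathcomp Require Import all_boot all_order all_algebra.
From mathcomp Require Import boolp classical_sets functions cardinality.
Set Implicit Arguments.
Unset Strict Implicit.
Unset Printing Implicit Defensive.

Local Open Scope classical_set_scope.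

Definition posint : Type := {n : nat | 0 < n}.

(* An equation in x, y, z is represented by its solution relation on the
   positive integers. A colouring need not use all k colours. *)
Definition Ramsey (k : nat) (E : posint -> posint -> posint -> Prop) : Prop :=
  forall c : posint -> 'I_k,
    infinite_set [set t : posint * posint * posint |
      let: (x, y, z) := t in [/\ E x y z, c x = c y & c y = c z]].

(* Main.v *)
Require Import Defs.
From mathcomp Require Import all_boot all_order all_algebra.
From mathcomp Require Import zify ring.
From mathcomp Require Import boolp classical_sets cardinality.
Import Order.TTheory GRing.Theory Num.Theory.
Local Open Scope ring_scope.

(* Suppose that no solution with z >= Z0 is monochromatic, and look at the
   colours of the multiples of M = ab(a + b). If z and w are such multiples, z
   is red and w is blue, then y red gives x = (p(z) - by)/a blue, hence
   y' = y + (p(w) - p(z))/b red.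

   Both colours occur arbitrarily far, since otherwise x = y = p(z)/(a + b)
   would be a solution. Take consecutive colour changes red -> blue -> red. If
   they are at bounded distance, the corresponding shifts, one up and one down,
   generate a rotation under which x0 = p(z)/(a + b) returns to itself, although
   x0 is blue and its first image is red. Otherwise a long blue block ends at a
   red z. Blue is then closed under adding (p(z) - p(z - h))/b for bounded h, and
   sums of the numbers p(z) - p(z - h) meet every interval of some bounded length
   around p(z): this produces x and y, reached from the blue block, with
   ax + by = p(w) for some w in the block. *)

(** * Finite differences of integer polynomials *)

(** Induction in Horner form: an integer [q.[z] > 0] is at least 1, so [q.[z] * z + c >= z + c],
    which is positive for large [z]. *)
Lemma horner_eventually_gt0 (p : {poly int}) (n : nat) :
  (size p <= n.+1)%N -> 0 < p`_n ->
  exists T : int, forall z : int, T <= z -> 0 < p.[z].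
Proof.
have aux (u v w : int) : w <= u -> 1 - v <= w -> 0 < u + v by lia.
elim/poly_ind: p n => [|q c IHq] n; first by rewrite coef0 ltxx.
case: n => [/size1_polyC ->|n hs].
  by rewrite coefC /= => c_gt0; exists 0 => z _; rewrite hornerC.
rewrite coefD coefMX coefC /= addr0 => qn_gt0.
have [|T hT] := IHq n _ qn_gt0.
  move: hs; rewrite size_MXaddC; case: ifP => [/andP[/eqP -> _]|_]; last by [].
  by rewrite size_poly0.
exists (Num.max T (Num.max 1 (1 - c))) => z; rewrite !ge_max => /and3P[Tz z1 zc].
have q_ge1 : 1 <= q.[z] by have := hT z Tz; lia.
have qz_ge : z <= q.[z] * z by apply: ler_peMl; lia.
by rewrite hornerMXaddC; apply: aux qz_ge zc.
Qed.

Lemma coefM_top (R : nzRingType) (p q : {poly R}) (m n : nat) :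
  (size p <= m.+1)%N -> (size q <= n.+1)%N -> (p * q)`_(m + n) = p`_m * q`_n.
Proof.
move=> hp hq; rewrite coefM.
have hm : (m < (m + n).+1)%N by lia.
rewrite (bigD1 (Ordinal hm)) //= big1 ?addr0; first by congr (_ * _`__); lia.
move=> [i hi] /=; rewrite -val_eqE /= => ne_im.
have [lt_im|le_mi] := ltnP i m.
  by rewrite [q`__]nth_default ?mulr0 // (leq_trans hq) //; lia.
rewrite nth_default ?mul0r // (leq_trans hp) // ltn_neqAle le_mi andbT.
by rewrite eq_sym.
Qed.

Lemma dvdz_horner_sub (p : {poly int}) (x y : int) : (x - y %| p.[x] - p.[y])%Z.
Proof.
elim/poly_ind: p => [|q c IHq]; first by rewrite !horner0 subrr dvdz0.
have [k Ek] := dvdzP IHq; apply/dvdzP; exists (k * x + q.[y]).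
rewrite !hornerMXaddC.
transitivity ((q.[x] - q.[y]) * x + q.[y] * (x - y)); first by ring.
by rewrite Ek; ring.
Qed.

Definition nabla (h : int) (p : {poly int}) : {poly int} := p - (p \Po ('X - h%:P)).

Lemma horner_nabla h p z : (nabla h p).[z] = p.[z] - p.[z - h].
Proof. by rewrite /nabla hornerD hornerN horner_comp hornerXsubC. Qed.

Lemma nabla0 p : nabla 0 p = 0.
Proof. by rewrite /nabla subr0 comp_polyXr subrr. Qed.

Lemma nablaD h p q : nabla h (p + q) = nabla h p + nabla h q.
Proof. by rewrite /nabla comp_polyD; ring. Qed.

Lemma nablaB h p q : nabla h (p - q) = nabla h p - nabla h q.
Proof. by rewrite /nabla comp_polyB; ring. Qed.

Lemma nabla_sum (I : Type) (r : seq I) (F : I -> {poly int}) h :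
  nabla h (\sum_(i <- r) F i) = \sum_(i <- r) nabla h (F i).
Proof.
apply: (big_morph (nabla h) (nablaD h)).
by rewrite /nabla comp_poly0 subrr.
Qed.

(** With S_h the shift by h, each difference is 1 - S_h, and (1 - S_g)(1 - S_h) = (1 - S_g) + (1 -
    S_h) - (1 - S_{g+h}). *)
Lemma nabla_nabla g h p : nabla h (nabla g p) = nabla g p + nabla h p - nabla (g + h) p.
Proof.
rewrite /nabla comp_polyB -comp_polyA.
have -> : ('X - g%:P) \Po ('X - h%:P) = 'X - (g + h)%:P.
  by rewrite comp_polyB comp_polyX comp_polyC polyCD; ring.
by ring.
Qed.

Lemma coef_nabla (h : int) (p : {poly int}) (n : nat) : (size p <= n.+2)%N ->
  (size (nabla h p) <= n.+1)%N /\ (nabla h p)`_n = n.+1%:R * h * p`_n.+1.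
Proof.
elim/poly_ind: p n => [|q c IHq] n hs.
  by rewrite /nabla comp_poly0 subrr size_poly0 !coef0 mulr0.
have sq : (size q <= n.+1)%N.
  move: hs; rewrite size_MXaddC; case: ifP => [/andP[/eqP -> _]|_] //.
  by rewrite size_poly0.
(* Discrete product rule, adapted to the Horner induction. *)
have -> : nabla h (q * 'X + c%:P) = nabla h q * ('X - h%:P) + h *: q.
  rewrite /nabla comp_polyD comp_polyM comp_polyX comp_polyC -mul_polyC; ring.
rewrite mulrBr coefD coefB coefMX coefMC coefZ.
rewrite [(q * 'X + _)`__]coefD coefMX coefC addr0 /=.
case: n hs sq => [|n] hs sq.
  have -> : nabla h q = 0 by rewrite (size1_polyC sq) /nabla comp_polyC subrr.
  rewrite !mul0r subr0 add0r coef0 mul0r; split; last by rewrite /=; ring.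
  exact: leq_trans (size_scale_leq _ _) sq.
have [s1 c1] := IHq n sq.
split; last first.
  rewrite c1 [(nabla h q)`_n.+1]nth_default //= ; ring.
apply/leq_sizeP => j hj.
rewrite coefD coefB coefMX coefMC coefZ.
rewrite [q`_j]nth_default; last exact: leq_trans sq hj.
rewrite (nth_default _ (_ : size (nabla h q) <= j)%N); last by lia.
case: j hj => [//|j] hj /=; rewrite nth_default ?mul0r ?mulr0 ?subr0 ?addr0 //.
exact: leq_trans s1 hj.
Qed.

Lemma coef_iter_nabla (h : int) (p : {poly int}) (D k : nat) :
  (size p <= D.+1)%N -> (k <= D)%N ->
  (size (iter k (nabla h) p) <= (D - k).+1)%N /\
  (iter k (nabla h) p)`_(D - k) = (D ^_ k)%:R * h ^+ k * p`_D.
Proof.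
move=> sp; elim: k => [|k IHk] kD; first by rewrite subn0 ffactn0 expr0 !mul1r.
have [] := IHk (ltnW kD).
have -> : (D - k = (D - k.+1).+1)%N by lia.
move=> s1 c1; have [s2 c2] := @coef_nabla h _ _ s1.
rewrite iterS; split=> //; rewrite c2 c1 ffactnSr natrM.
have -> : (D - k = (D - k.+1).+1)%N by lia.
rewrite exprS; ring.
Qed.

(** By [nabla_nabla], one more difference turns the multiple [i] into [i], into [i + 1] with
    opposite sign, and into an extra [nabla h p]. The extra terms cancel because both lists have the
    same length. *)
Lemma iter_nabla_split (k : nat) : exists P N : seq nat,
  [/\ all (fun i => i <= k.+1)%N P, all (fun i => i <= k.+1)%N N, size P = size N
    & forall h p, iter k.+1 (nabla h) p =
        \sum_(i <- N) nabla (h *+ i) p - \sum_(i <- P) nabla (h *+ i) p].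
Proof.
elim: k => [|k [P [N [aP aN sPN IH]]]].
  exists [:: 0%N], [:: 1%N]; split=> // h p.
  by rewrite !big_seq1 mulr0n mulr1n nabla0 subr0.
exists (P ++ map succn N), (N ++ map succn P); split.
- rewrite all_cat all_map; apply/andP; split; last exact: aN.
  by apply: sub_all aP => i /= /leqW.
- rewrite all_cat all_map; apply/andP; split; last exact: aP.
  by apply: sub_all aN => i /= /leqW.
- by rewrite !size_cat !size_map sPN.
move=> h p; rewrite iterS IH nablaB !nabla_sum.
have E s : \sum_(i <- s) nabla h (nabla (h *+ i) p) =
   \sum_(i <- s) nabla (h *+ i) p + nabla h p *+ size s
   - \sum_(i <- map succn s) nabla (h *+ i) p.
  elim: s => [|i s IHs]; first by rewrite /= !big_nil mulr0n; ring.
  rewrite /= !big_cons IHs nabla_nabla !mulrSr.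
  by move: (_ *+ size s) => t; ring.
rewrite !E sPN !big_cat /=.
by move: (_ *+ size N) => t; ring.
Qed.

(** * Sums of the differences p(z) - p(z - h) *)

(** Each term divided by [b] is a shift that preserves blue when [z] is red and [z - h] is blue; [J]
    bounds how far below [z] the blue block must reach. *)
Inductive reach (p : {poly int}) (M J z : int) : int -> Prop :=
| reach0 : reach p M J z 0
| reachS Y h : (M %| h)%Z -> 0 <= h <= J -> reach p M J z Y ->
    reach p M J z (Y + (p.[z] - p.[z - h])).

Lemma reachD p M J z Y1 Y2 :
  reach p M J z Y1 -> reach p M J z Y2 -> reach p M J z (Y1 + Y2).
Proof.
move=> r1; elim=> [|Y h Mh hJ _ IH]; first by rewrite addr0.
by rewrite addrA; apply: reachS.
Qed.

Lemma reach_mulrn p M J z Y n : reach p M J z Y -> reach p M J z (Y *+ n).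
Proof.
by move=> rY; elim: n => [|n IH]; rewrite ?mulr0n ?mulrS; [exact: reach0 | exact: reachD].
Qed.

Lemma reach_le p M J J' z Y : J <= J' -> reach p M J z Y -> reach p M J' z Y.
Proof.
move=> leJ; elim=> [|X h Mh /andP[h0 hJ] _ IH]; first exact: reach0.
by apply: reachS => //; rewrite h0 (le_trans hJ).
Qed.

Lemma reach_nabla p M J z h : (M %| h)%Z -> 0 <= h <= J ->
  reach p M J z (nabla h p).[z].
Proof.
move=> Mh hJ; rewrite horner_nabla -[_ - _]add0r.
by apply: reachS => //; exact: reach0.
Qed.

Lemma reach_sum p M J z h (s : seq nat) (k : nat) :
  (M %| h)%Z -> 0 <= h -> h *+ k <= J -> all (fun i => i <= k)%N s ->
  reach p M J z (\sum_(i <- s) nabla (h *+ i) p).[z].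
Proof.
move=> Mh h0 hJ; elim: s => [|i s IH] /=; first by rewrite big_nil horner0 => _; exact: reach0.
case/andP=> ik /IH; rewrite big_cons hornerD; apply: reachD.
apply: reach_nabla; first by rewrite -mulr_natr dvdz_mulr.
by rewrite mulrn_wge0 //= (le_trans _ hJ) // ler_wpMn2l.
Qed.

Lemma mulrn_abszE (x n : int) : 0 <= n -> x *+ `|n|%N = x * n.
Proof. by move=> n_ge0; rewrite -mulr_natr natz gez0_abs. Qed.

(* Replacing q copies of O by copies of E = O - G' lowers the sum by q G'. *)
Lemma reach_refine p M J z (G O E G' N X : int) :
  reach p M J z O -> reach p M J z E -> O - E = G' -> 0 < G' ->
  0 <= N -> G <= N * G' ->
  (exists Y, reach p M J z Y /\ X - N * O <= Y <= X - N * O + G) ->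
  exists Y, reach p M J z Y /\ X <= Y <= X + G'.
Proof.
move=> rO rE EG G'_gt0 N_ge0 GN [Y [rY /andP[Y1 Y2]]].
set q := ((Y - (X - N * O)) %/ G')%Z; set r := ((Y - (X - N * O)) %% G')%Z.
have Eqr : Y - (X - N * O) = q * G' + r by exact: divz_eq.
have r_ge0 : 0 <= r by apply: modz_ge0; lia.
have r_lt : r < G' by apply: ltz_pmod.
have q_ge0 : 0 <= q by nia.
have q_leN : q <= N by nia.
exists (Y + E *+ `|q|%N + O *+ `|N - q|%N); split.
  by apply: reachD; [apply: reachD => // |]; apply: reach_mulrn.
have -> : Y + E *+ `|q|%N + O *+ `|N - q|%N = X + r.
  rewrite !mulrn_abszE ?subr_ge0 //.
  have -> : E = O - G' by rewrite -EG; ring.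
  by have -> : Y = q * G' + r + (X - N * O); [rewrite -Eqr|]; ring.
lia.
Qed.

(* For k = D the polynomial G is constant; m allows X to be a fixed small
   fraction of p(z), which is what the induction on k consumes. *)
Definition window (p : {poly int}) (M : int) (D k : nat) : Prop :=
  forall m : int, 0 < m -> exists (G : {poly int}) (J T : int),
    (size G <= (D - k).+1)%N /\
    forall z X : int, T <= z -> p.[z] <= m * X ->
      exists Y, reach p M J z Y /\ X <= Y <= X + G.[z].

(** Rounding [X] up to a multiple of the single difference [(nabla M p).[z]] overshoots by at most
    that difference. *)
Lemma window1 (p : {poly int}) (M : int) (D : nat) :
  (0 < D)%N -> (size p <= D.+1)%N -> 0 < p`_D -> 0 < M -> window p M D 1.
Proof.
case: D => [//|D] _ sp pD M_gt0 m m_gt0; rewrite subn1 /=.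
have [sd cd] := @coef_nabla M p D sp.
have [T1 hT1] := @horner_eventually_gt0 _ _ sp pD.
have [|T2 hT2] := @horner_eventually_gt0 _ _ sd.
  by rewrite cd !mulr_gt0.
exists (nabla M p), M, (Num.max T1 T2); split=> // z X; rewrite ge_max => /andP[Tz1 Tz2] hX.
have := hT1 z Tz1; have := hT2 z Tz2; set d := (nabla M p).[z] => d_gt0 pz_gt0.
have X_gt0 : 0 < X by rewrite -(pmulr_rgt0 _ m_gt0); apply: lt_le_trans hX.
have rd : reach p M M z d by apply: reach_nabla => //; lia.
exists (d *+ `|((X %/ d)%Z + 1)%R|%N); split; first exact: reach_mulrn.
have E := divz_eq X d; have r_ge0 : 0 <= (X %% d)%Z by apply: modz_ge0; lia.
have r_lt : (X %% d)%Z < d by apply: ltz_pmod.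
have q_ge0 : 0 <= (X %/ d)%Z by rewrite divz_ge0 //; lia.
rewrite mulrn_abszE; last by lia.
nia.
Qed.

(** The top coefficient is linear in [h], whereas that of a k-th difference grows like [h ^+ k];
    [windowS] plays these against each other. *)
Lemma sum_nabla_coef (p : {poly int}) (D : nat) (h : int) (s : seq nat) :
  (size p <= D.+2)%N ->
  (size (\sum_(i <- s) nabla (h *+ i) p)%R <= D.+1)%N /\
  (\sum_(i <- s) nabla (h *+ i) p)`_D = D.+1%:R * (h *+ sumn s) * p`_D.+1.
Proof.
move=> sp; elim: s => [|i s [IHs IHc]] /=.
  by rewrite big_nil size_poly0 coef0 mulr0n mulr0 mul0r.
have [s1 c1] := @coef_nabla (h *+ i) p D sp.
rewrite big_cons coefD c1 IHc mulrnDr; split; last by ring.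
by rewrite (leq_trans (size_polyD _ _)) // geq_max s1.
Qed.

(* The k+1-st difference of p with step h is a difference O - E of two reachable
   sums. Covering gaps of length G takes about G / (O - E) copies of O, and for
   large h this costs only a small fraction of p(z). *)
Lemma windowS (p : {poly int}) (M : int) (D k : nat) :
  (0 < k < D)%N -> (size p <= D.+1)%N -> 0 < p`_D -> 0 < M ->
  window p M D k -> window p M D k.+1.
Proof.
move=> /andP[k_gt0 kD] sp pD M_gt0 W m m_gt0.
(* The factor 2 leaves room to apply the hypothesis to [X - n * O.[z]], where [n * O.[z]] will cost
   at most [p.[z] / (2 * m)]. *)
have [|G [J [T1 [sG hG]]]] := W (2 * m); first by rewrite mulr_gt0.
have [P [N [aP aN sPN hPN]]] := iter_nabla_split k.
case: D kD sp pD W sG hG => [//|D] kD sp pD W sG hG.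
pose g : int := `|G`_(D.+1 - k)|; pose c : int := (sumn N)%:Z.
(* A multiple of [M] so large that the top coefficient of [(2 * m) *: (G * O)], linear in [h], stays
   below that of [p * G'], which is at least of order [h ^+ 2]. *)
pose h : int := M * (2 * m * g * D.+1%:R * c + 1).
have g_ge0 : 0 <= g by exact: normr_ge0.
have c_ge0 : 0 <= c by [].
have B_ge0 : 0 <= 2 * m * g * D.+1%:R * c by rewrite !mulr_ge0 // ltW.
have h_gt0 : 0 < h by rewrite mulr_gt0 //; lia.
have h_big : 2 * m * g * D.+1%:R * c < h by rewrite /h; nia.
have Mh : (M %| h)%Z by rewrite dvdz_mulr.
clearbody h.
pose O := \sum_(i <- N) nabla (h *+ i) p; pose E := \sum_(i <- P) nabla (h *+ i) p.
pose G' := iter k.+1 (nabla h) p.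
have EG' : G' = O - E by exact: hPN.
have [sG' cG'] := @coef_iter_nabla h p D.+1 k.+1 sp kD.
have [sO cO] := @sum_nabla_coef p D h N sp.
have G'_lead : h ^+ k.+1 * p`_D.+1 <= G'`_(D.+1 - k.+1).
  rewrite cG' -mulrA ler_peMl //; first by rewrite mulr_ge0 ?exprn_ge0 // ltW.
  by rewrite -[1]/(1%:R) ler_nat ffact_gt0.
have hk_gt0 : 0 < h ^+ k.+1 * p`_D.+1 by rewrite mulr_gt0 ?exprn_gt0.
have [|T2 hT2] := @horner_eventually_gt0 _ _ sG'; first exact: lt_le_trans G'_lead.
have [T3 hT3] := @horner_eventually_gt0 _ _ sp pD.
(* Positivity of [Q] bounds the cost of about [G / G'] copies of [O]. Both products have the same
   formal degree, where [G'] contributes nothing to [G + G']. *)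
pose Q := p * G' - (2 * m) *: ((G + G') * O).
have sGG : (size (G + G')%R <= (D.+1 - k).+1)%N.
  rewrite (leq_trans (size_polyD _ _)) // geq_max sG (leq_trans sG') //; lia.
have [T4 hT4] : exists T : int, forall z : int, T <= z -> 0 < Q.[z].
  apply: (@horner_eventually_gt0 _ (D.+1 + (D.+1 - k.+1))%N).
    have szM (f q : {poly int}) (i j l : nat) : (size f <= i.+1)%N ->
        (size q <= j.+1)%N -> (i + j = l)%N -> (size (f * q)%R <= l.+1)%N.
      move=> fi qj <-; rewrite (leq_trans (size_polyMleq _ _)) //; lia.
    rewrite (leq_trans (size_polyD _ _)) // size_polyN geq_max (szM _ _ _ _ _ sp sG') //=.
    rewrite (leq_trans (size_scale_leq _ _)) // (szM _ _ _ _ _ sGG sO) //; lia.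
  rewrite coefB coefZ (coefM_top _ _ _ _ _ sp sG').
  have -> : (D.+1 + (D.+1 - k.+1) = (D.+1 - k) + D)%N by lia.
  have top : (G + G')`_(D.+1 - k) = G`_(D.+1 - k).
    have G'0 : G'`_(D.+1 - k) = 0.
      by apply: nth_default; rewrite (leq_trans sG') //; lia.
    by rewrite coefD G'0 addr0.
  rewrite (coefM_top _ _ _ _ _ sGG sO) top cO subr_gt0.
  have -> : h *+ sumn N = h * c by rewrite -mulr_natr natz.
  set pD1 := p`_D.+1 in pD *.
  have G_leg : G`_(D.+1 - k) <= g by exact: ler_norm.
  apply: (@le_lt_trans _ _ (2 * m * g * D.+1%:R * c * (h * pD1))).
    have -> : 2 * m * (G`_(D.+1 - k) * (D.+1%:R * (h * c) * pD1)) =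
        G`_(D.+1 - k) * (2 * m * D.+1%:R * c * (h * pD1)) by ring.
    have -> : 2 * m * g * D.+1%:R * c * (h * pD1) =
        g * (2 * m * D.+1%:R * c * (h * pD1)) by ring.
    by rewrite ler_wpM2r // !mulr_ge0 //; apply: ltW.
  apply: (@lt_le_trans _ _ (h * (h * pD1))); first by rewrite ltr_pM2r // mulr_gt0.
  apply: (@le_trans _ _ (h ^+ k.+1 * pD1)).
    rewrite mulrA ler_pM2r // -expr2 ler_weXn2l //; lia.
  by apply: (le_trans G'_lead); rewrite ler_peMl //; apply: le_trans (ltW hk_gt0) G'_lead.
exists G', (Num.max J (h *+ k.+1)), (Num.max T1 (Num.max T2 (Num.max T3 T4))); split.
  by rewrite subSS in sG' *.
move=> z X; rewrite !ge_max => /and4P[zT1 zT2 zT3 zT4] hX.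
have G'_gt0 : 0 < G'.[z] := hT2 z zT2.
have p_gt0 := hT3 z zT3; have Q_gt0 := hT4 z zT4.
have G_ge0 : 0 <= G.[z].
  have [|Y [_ /andP[Y1 Y2]]] := hG z p.[z] zT1; first by nia.
  by have := le_trans Y1 Y2; rewrite lerDl.
pose n := (G.[z] %/ G'.[z])%Z + 1.
have Eqr := divz_eq G.[z] G'.[z]; have r_ge0 : 0 <= (G.[z] %% G'.[z])%Z by rewrite modz_ge0 ?gt_eqF.
have r_lt : (G.[z] %% G'.[z])%Z < G'.[z] by apply: ltz_pmod.
have q_ge0 : 0 <= (G.[z] %/ G'.[z])%Z by rewrite divz_ge0 //; lia.
have n_ge0 : 0 <= n by rewrite /n; lia.
have Gn : G.[z] <= n * G'.[z] by rewrite /n; lia.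
have cost : 2 * m * (n * O.[z]) <= p.[z].
  have [O_lt0|O_ge0] := ltP O.[z] 0; first by nia.
  rewrite -(ler_pM2r G'_gt0); apply: (@le_trans _ _ (2 * m * ((G.[z] + G'.[z]) * O.[z]))).
    have -> : 2 * m * (n * O.[z]) * G'.[z] = 2 * m * ((n * G'.[z]) * O.[z]) by ring.
    by rewrite ler_pM2l ?mulr_gt0 // ler_wpM2r // /n; lia.
  have hornerQ (f q o r : {poly int}) (l x : int) :
      (f * q - l *: ((r + q) * o)).[x] = f.[x] * q.[x] - l * ((r.[x] + q.[x]) * o.[x]).
    by rewrite hornerD hornerN hornerZ !hornerM hornerD.
  by move: Q_gt0; rewrite /Q hornerQ subr_gt0; exact: ltW.
apply: (@reach_refine p M _ z G.[z] O.[z] E.[z] G'.[z] n) => //.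
- by apply: (@reach_sum _ _ _ _ _ _ k.+1) => //; [exact: ltW | rewrite le_max lexx orbT].
- by apply: (@reach_sum _ _ _ _ _ _ k.+1) => //; [exact: ltW | rewrite le_max lexx orbT].
- by rewrite EG' hornerD hornerN.
have [|Y [rY hY]] := hG z (X - n * O.[z]) zT1; first by nia.
by exists Y; split=> //; apply: reach_le rY; rewrite le_max lexx.
Qed.

(** * Colourings without monochromatic solutions *)

Lemma dvdz_horner (p : {poly int}) (d x : int) :
  p`_0 = 0 -> (d %| x)%Z -> (d %| p.[x])%Z.
Proof.
move=> p0 dx; apply: dvdz_trans dx _.
by have := dvdz_horner_sub p x 0; rewrite horner_coef0 p0 !subr0.
Qed.

Lemma reach_dvd p M J z Y : reach p M J z Y -> (M %| Y)%Z.
Proof.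
elim=> [|X h Mh _ _ IH]; first exact: dvdz0.
rewrite rpredD //; apply: dvdz_trans Mh _.
by have := dvdz_horner_sub p z (z - h); rewrite subKr.
Qed.

Lemma horner_eventually_mono (p : {poly int}) (D : nat) :
  (0 < D)%N -> (size p <= D.+1)%N -> 0 < p`_D ->
  exists T : int, forall x y : int, T <= x -> x < y -> p.[x] < p.[y].
Proof.
case: D => [//|D] _ sp pD; have [sd cd] := @coef_nabla 1 p D sp.
have [|T hT] := @horner_eventually_gt0 _ _ sd; first by rewrite cd mulr1 mulr_gt0.
exists T => x y Tx xy; have -> : y = x + `|(y - x - 1)%R|%N.+1%:Z by lia.
elim: `|_|%N => [|n IHn].
  by have := hT (x + 1); rewrite horner_nabla addrK subr_gt0; apply; lia.
apply: lt_trans IHn _; have := hT (x + n.+2%:Z).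
rewrite horner_nabla subr_gt0.
have -> : x + n.+2%:Z - 1 = x + n.+1%:Z by lia.
by apply; lia.
Qed.

Lemma multiple_between (d x : int) : 0 < d ->
  exists w : int, [/\ (d %| w)%Z, x - d <= w & w <= x].
Proof.
move=> d_gt0; exists ((x %/ d)%Z * d); rewrite dvdz_mull //.
have E := divz_eq x d; have r_ge0 : 0 <= (x %% d)%Z by rewrite modz_ge0 ?gt_eqF.
have r_lt : (x %% d)%Z < d by exact: ltz_pmod.
by split=> //; lia.
Qed.

(** A colouring with finitely many monochromatic solutions has this property once [Z0] exceeds all
    their [z]. *)
Definition mono_free (a b : int) (p : {poly int}) (Z0 : int) (col : int -> bool) : Prop :=
  forall x y z, 0 < x -> 0 < y -> Z0 <= z -> a * x + b * y = p.[z] ->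
    col x = col z -> col y <> col z.

(** The partner [x] of [y] at [z] gets the colour of [w], so the partner [y'] of [x] at [w] gets the
    colour of [z]. Divisibility by [a] makes [x] integral, and is passed on to [y'] so that steps
    can be iterated. *)
Lemma mono_free_step (a b M Z0 : int) (p : {poly int}) (col : int -> bool) (z w y y' : int) :
  mono_free a b p Z0 col -> 0 < a -> 0 < b -> (a * b %| M)%Z -> p`_0 = 0 ->
  (M %| z)%Z -> (M %| w)%Z -> Z0 <= z -> Z0 <= w -> col w = ~~ col z ->
  (a %| y)%Z -> col y = col z -> 0 < y -> b * y < p.[z] ->
  b * y' = b * y + (p.[w] - p.[z]) -> 0 < y' ->
  (a %| y')%Z /\ col y' = col z.
Proof.
move=> mf a0 b0 abM p0 Mz Mw Zz Zw colw ay coly y0 byp Ey' y'0.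
have [k Ek] := dvdzP (dvdz_horner p _ _ p0 (dvdz_trans abM Mz)).
have [l El] := dvdzP (dvdz_horner p _ _ p0 (dvdz_trans abM Mw)).
have [j Ej] := dvdzP ay.
have Ey'2 : y' = (j + l - k) * a.
  apply: (@mulfI _ b); first by rewrite gt_eqF.
  by rewrite Ey' Ek El Ej; ring.
split; first by rewrite Ey'2 dvdz_mull.
pose x : int := b * (k - j).
have Ex : a * x + b * y = p.[z] by rewrite /x Ek Ej; ring.
have x0 : 0 < x by rewrite -(pmulr_rgt0 _ a0) -(addrK (b * y) (a * x)) Ex subr_gt0.
have colx : col x = col w.
  have := mf x y z x0 y0 Zz Ex; rewrite colw coly.
  by case: (col x); case: (col z) => // H; case: H.
have Ex' : a * x + b * y' = p.[w] by rewrite Ey' -Ex; ring.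
by have := mf x y' w x0 y'0 Zw Ex' colx; rewrite colw; case: (col y'); case: (col z).
Qed.

(* With e = (p(w) - p(z))/b and e' = (p(z') - p(w'))/b, moving up by e below
   x0 = p(z)/(a + b) and down by e' from x0 on is a rotation of an interval of
   length e + e', so the orbit of x0 returns to x0. *)
Lemma near_switches (a b M Z0 : int) (p : {poly int}) (col : int -> bool) (z w z' w' : int) :
  mono_free a b p Z0 col -> 0 < a -> 0 < b -> M = a * b * (a + b) -> p`_0 = 0 ->
  (M %| z)%Z -> (M %| w)%Z -> (M %| z')%Z -> (M %| w')%Z ->
  Z0 <= z -> Z0 <= w -> Z0 <= z' -> Z0 <= w' ->
  col w = ~~ col z -> col z' = col z -> col w' = ~~ col z ->
  0 < p.[z] -> p.[z] < p.[w] -> p.[w'] < p.[z'] -> p.[w] <= p.[z'] ->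
  (a + b) * (p.[z'] - p.[w']) < b * p.[z] -> False.
Proof.
move=> mf a0 b0 EM p0 Mz Mw Mz' Mw' Zz Zw Zz' Zw' colw colz' colw' pz pzw pwz' pwz small.
have [k Ek] := dvdzP (dvdz_horner p _ _ p0 Mz).
have [l El] := dvdzP (dvdz_horner p _ _ p0 Mw).
have [k' Ek'] := dvdzP (dvdz_horner p _ _ p0 Mz').
have [l' El'] := dvdzP (dvdz_horner p _ _ p0 Mw').
have abM : (a * b %| M)%Z by rewrite EM dvdz_mulr.
pose x0 : int := k * (a * b).
pose e : int := (l - k) * (a * (a + b)); pose e' : int := (k' - l') * (a * (a + b)).
have Ex0 : p.[z] = (a + b) * x0 by rewrite Ek EM /x0; ring.
have Ee : p.[w] - p.[z] = b * e by rewrite Ek El EM /e; ring.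
have Ee' : p.[z'] - p.[w'] = b * e' by rewrite Ek' El' EM /e'; ring.
have ax0 : (a %| x0)%Z by rewrite /x0 mulrA mulrAC dvdz_mull.
have ae : (a %| e)%Z by rewrite /e mulrCA dvdz_mulr.
have ae' : (a %| e')%Z by rewrite /e' mulrCA dvdz_mulr.
have up_step y y' := @mono_free_step _ _ _ _ _ _ z w y y' mf a0 b0 abM p0 Mz Mw Zz Zw colw.
have colw'z' : col w' = ~~ col z' by rewrite colz'.
have down_step y y' :=
  @mono_free_step _ _ _ _ _ _ z' w' y y' mf a0 b0 abM p0 Mz' Mw' Zz' Zw' colw'z'.
clearbody x0 e e'; clear k Ek l El k' Ek' l' El' EM abM Mz Mw Mz' Mw'.
have ab0 : 0 < a + b by exact: addr_gt0.
have e_gt0 : 0 < e by rewrite -(pmulr_rgt0 _ b0) -Ee subr_gt0.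
have e'_gt0 : 0 < e' by rewrite -(pmulr_rgt0 _ b0) -Ee' subr_gt0.
have x0_gt0 : 0 < x0 by rewrite -(pmulr_rgt0 _ ab0) -Ex0.
(* Hence the interval from [x0 - e'] to [x0 + e] contains only positive numbers. *)
have e'x0 : e' < x0.
  rewrite -(ltr_pM2l b0) -(ltr_pM2l ab0) -Ee'.
  by have -> : (a + b) * (b * x0) = b * p.[z] by rewrite Ex0; ring.
clear small.
have colx0 : col x0 = ~~ col z.
  have := mf x0 x0 z x0_gt0 x0_gt0 Zz; rewrite -mulrDl -Ex0 => /(_ erefl).
  by case: (col x0); case: (col z) => // H; case: H.
have colx0e : col (x0 + e) = col z.
  have E : a * x0 + b * (x0 + e) = p.[w].
    by rewrite mulrDr -Ee Ex0; ring.
  have /(_ _ _) := mf x0 (x0 + e) w x0_gt0 _ Zw E.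
  rewrite colx0 colw => /(_ _ erefl) H.
  have {}H : col (x0 + e) <> ~~ col z by apply: H; exact: addr_gt0.
  by move: H; case: (col (x0 + e)); case: (col z).
(* The position, counted from [x0 - e'], after [n] moves from [x0]: adding [e] modulo [e + e'] means
   up by [e] below [x0] and down by [e'] from [x0] on. *)
pose v n : int := ((e' + n%:Z * e) %% (e + e'))%Z.
have ee'_gt0 : 0 < e + e' by exact: addr_gt0.
have v_bnd n : 0 <= v n < e + e' by rewrite modz_ge0 ?ltz_pmod // gt_eqF.
have up n : v n < e' -> v n.+1 = v n + e.
  move=> vn; rewrite /v (_ : e' + n.+1%:Z * e = (e' + n%:Z * e) + e); last by rewrite intS; ring.
  by rewrite -modzDml modz_small // -/(v n); have := v_bnd n; clear -vn e_gt0; lia.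
have down n : e' <= v n -> v n.+1 = v n - e'.
  move=> vn; rewrite /v.
  rewrite (_ : e' + n.+1%:Z * e = (e' + n%:Z * e) - e' + (e + e')); last by rewrite intS; ring.
  by rewrite modzDr -modzDml modz_small // -/(v n); have := v_bnd n; clear -vn e'_gt0; lia.
have v2 : v 2 = e.
  rewrite /v (_ : e' + 2%:Z * e = e + (e + e')); last by ring.
  by rewrite modzDr modz_small // (ltW e_gt0) ltrDl.
have vN : v `|(e + e')%R|%N = e'.
  rewrite /v gez0_abs ?ltW // addrC -modzDml modzMr add0r modz_small //.
  by rewrite (ltW e'_gt0) ltrDr.
clearbody v.
have byz' y : y <= x0 + e -> b * y < p.[z'].
  move=> hy; apply: lt_le_trans pwz.
  apply: (@le_lt_trans _ _ (b * (x0 + e))); first by rewrite ler_pM2l.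
  rewrite mulrDr -Ee addrCA gtrDl Ex0 -mulrBl pmulr_llt0 //.
  by rewrite opprD addrCA subrr addr0 oppr_lt0.
(* The orbit is followed from index 2: [x0] has the wrong colour, but [x0 + e], at the excluded end
   of the interval, has the colour of [z] and moves down to position [e = v 2]. *)
have orbit n : (a %| (x0 - e' + v n.+2)%R)%Z /\ col (x0 - e' + v n.+2) = col z.
  elim: n => [|n [an cn]].
    have -> : x0 - e' + v 2 = x0 + e - e' by rewrite v2; ring.
    rewrite -colz'; apply: (down_step (x0 + e)).
    + by rewrite rpredD.
    + by rewrite colz'.
    + by clear -e_gt0 e'_gt0 e'x0 x0_gt0; lia.
    + by apply: byz'.
    + by rewrite -[p.[w'] - _]opprB Ee'; ring.
    + by clear -e_gt0 e'_gt0 e'x0 x0_gt0; lia.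
  have := v_bnd n.+2; have [vn|vn] := ltP (v n.+2) e' => vb.
    rewrite (up _ vn); apply: (up_step (x0 - e' + v n.+2)) => //.
    + by clear -vb vn e_gt0 e'_gt0 e'x0 x0_gt0; lia.
    + rewrite Ex0; apply: (@lt_trans _ _ (b * x0)); last by rewrite ltr_pM2r // ltrDr.
      by rewrite ltr_pM2l //; clear -vn; lia.
    + by rewrite Ee; ring.
    + by clear -vb vn e_gt0 e'_gt0 e'x0 x0_gt0; lia.
  rewrite (down _ vn) -colz'; apply: (down_step (x0 - e' + v n.+2)) => //.
  + by rewrite colz'.
  + by clear -vb vn e_gt0 e'_gt0 e'x0 x0_gt0; lia.
  + by apply: byz'; clear -vb; lia.
  + by rewrite -[p.[w'] - _]opprB Ee'; ring.
  + by clear -vb vn e_gt0 e'_gt0 e'x0 x0_gt0; lia.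
have [_] := orbit (`|(e + e')%R|%N - 2)%N.
have -> : (`|(e + e')%R| - 2).+2%N = `|(e + e')%R|%N by clear -e_gt0 e'_gt0; lia.
rewrite vN; rewrite subrK colx0; by case: (col z).
Qed.

(** The window gives [Y] for which [y0 = (p.[w0] - Y) / (a + b)] lies in the block just below [z].
    Climbing from [y0] by [Y / b] keeps the block's colour and ends at [y] with [a * y0 + b * y = (a
    + b) * y0 + Y = p.[w0]]. *)
Lemma long_block (a b M C J g Z0 : int) (p : {poly int}) (col : int -> bool) (z : int) :
  mono_free a b p Z0 col -> 0 < a -> 0 < b -> M = a * b * (a + b) -> p`_0 = 0 ->
  (M %| z)%Z -> 0 < z - C -> Z0 <= z - C ->
  (forall w : int, (M %| w)%Z -> z - C <= w < z -> col w = ~~ col z) ->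
  0 < J -> 0 <= g -> J + M * (a + b) <= C -> g + 1 <= C ->
  (forall x y : int, z - C <= x -> x <= y -> p.[x] <= p.[y]) ->
  p.[z] <= 2 * (p.[z - (J + M * (a + b))] - (a + b) * (z - 1)) ->
  (forall X : int, p.[z] <= 2 * X -> exists Y, reach p (M * (a + b)) J z Y /\ X <= Y <= X + g) ->
  False.
Proof.
move=> mf a0 b0 EM p0 Mz zC ZC colB J0 g0 JC gC mono bnd win.
have M0 : 0 < M by rewrite EM !mulr_gt0 // addr_gt0.
have abM : (a * b %| M)%Z by rewrite EM dvdz_mulr.
set M' : int := M * (a + b) in JC bnd win.
have EM' : M' = M * (a + b) by [].
clearbody M'.
have M'0 : 0 < M' by rewrite EM' mulr_gt0 // addr_gt0.
have MM' : (M %| M')%Z by rewrite EM' dvdz_mulr.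
(* Below [z - J], so that [p.[w0] <= p.[z - h]] for every shift used and partners stay positive; a
   multiple of [M'], so that [y0] is a multiple of [M]. *)
have [w0 [M'w0 w0_lo w0_hi]] : exists w0 : int, [/\ (M' %| w0)%Z, z - (J + M') <= w0 & w0 <= z - J].
  have [w0 [dw0 lo hi]] := multiple_between _ (z - J) M'0.
  by exists w0; split=> //; lia.
have pw0 : p.[z - (J + M')] <= p.[w0] by apply: mono => //; clear -JC w0_lo w0_hi w0_lo J0; lia.
have [|Y [rY /andP[Y1 Y2]]] := win (p.[w0] - (a + b) * (z - 1)); first by clear -bnd pw0; lia.
have [n1 En1] := dvdzP (dvdz_horner p _ _ p0 M'w0).
have [n2 En2] := dvdzP (reach_dvd _ _ _ _ _ rY).
pose y0 : int := (n1 - n2) * M.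
have Ey0 : p.[w0] - Y = (a + b) * y0 by rewrite En1 En2 /y0 EM'; ring.
have ab0 : 0 < a + b by exact: addr_gt0.
have y0_hi : y0 <= z - 1 by rewrite -(ler_pM2l ab0) -Ey0; lia.
have y0_lo : z - 1 - y0 <= g.
  apply: (@le_trans _ _ ((a + b) * (z - 1 - y0))).
    by rewrite ler_peMl // subr_ge0.
  rewrite mulrBr -Ey0; lia.
have y0_gt0 : 0 < y0 by clear -y0_lo gC zC; lia.
have My0 : (M %| y0)%Z by rewrite dvdz_mull.
have coly0 : col y0 = ~~ col z.
  by apply: colB => //; clear -y0_hi y0_lo gC; lia.
have ay0 : (a %| y0)%Z by apply: dvdz_trans My0; apply: dvdz_trans abM; rewrite dvdz_mulr.
have colw0 : col w0 = ~~ col z.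
  by apply: colB; [exact: dvdz_trans MM' M'w0 | clear -w0_hi w0_lo JC J0; lia].
have w0C : z - C <= w0 by clear -w0_lo JC; lia.
have key X : reach p M' J z X -> forall y, b * y = b * y0 + X -> b * y < p.[w0] ->
    [/\ (a %| y)%Z, y0 <= y & col y = ~~ col z].
  elim=> [|X' h M'h /andP[h0 hJ] rX' IH] y Ey yw0.
    suff -> : y = y0 by [].
    by apply: (@mulfI _ b); rewrite ?Ey ?addr0 // gt_eqF.
  have Mzh : (M %| (z - h)%R)%Z by rewrite rpredB // (dvdz_trans MM').
  have [u Eu] := dvdzP (dvdz_horner p _ _ p0 (dvdz_trans abM Mz)).
  have [u' Eu'] := dvdzP (dvdz_horner p _ _ p0 (dvdz_trans abM Mzh)).
  pose y1 : int := y - (u - u') * a.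
  have Ey1 : b * y1 = b * y0 + X'.
    have -> : b * y1 = b * y - (p.[z] - p.[z - h]) by rewrite Eu Eu' /y1; ring.
    by rewrite Ey; ring.
  have zh : [/\ z - C <= z - h, z - h <= z, w0 <= z - h & (h != 0 -> z - h < z)].
    by clear -h0 hJ J0 JC M'0 w0_hi; split; lia.
  have le_zh : p.[z - h] <= p.[z] by case: zh => *; apply: mono.
  have le_w0zh : p.[w0] <= p.[z - h] by case: zh => _ _ zh3 _; exact: mono.
  have le_y1y : b * y1 <= b * y by rewrite Ey1 Ey lerD2l lerDl subr_ge0.
  have [ay1 y01 coly1] := IH y1 Ey1 (le_lt_trans le_y1y yw0).
  have y1y : y1 <= y by rewrite -(ler_pM2l b0).
  (* The trivial shift [h = 0] is separated because [z] itself is not in the block. *)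
  have [h_eq0|h_neq0] := eqVneq h 0.
    suff <- : y1 = y by [].
    apply: (@mulfI _ b); first by rewrite gt_eqF.
    by rewrite Ey1 Ey h_eq0 subr0 subrr addr0.
  have colzh : col (z - h) = ~~ col z.
    by case: zh => zh1 _ _ zh2; apply: colB; rewrite // zh1 zh2.
  rewrite -colzh.
  have [|||||||||ay coly] := @mono_free_step a b M Z0 p col (z - h) z y1 y mf a0 b0 abM p0 Mzh Mz.
  - by case: zh => zh1 _ _ _; exact: le_trans zh1.
  - by case: zh => zh1 zh2 _ _; exact: le_trans (le_trans ZC zh1) zh2.
  - by rewrite colzh negbK.
  - by [].
  - by rewrite colzh.
  - exact: lt_le_trans y01.
  - exact: le_lt_trans le_y1y (lt_le_trans yw0 le_w0zh).
  - by rewrite Ey1 Ey; ring.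
  - exact: lt_le_trans (lt_le_trans y0_gt0 y01) y1y.
  - by split=> //; exact: le_trans y1y.
pose y : int := y0 + n2 * (a * (a + b) * (a + b)).
have Ey : b * y = b * y0 + Y by rewrite En2 /y EM' EM; ring.
have Ew0 : a * y0 + b * y = p.[w0] by rewrite Ey -[p.[w0]](subrK Y) Ey0; ring.
have [|_ y0y coly] := key Y rY y Ey; first by rewrite -Ew0 ltrDr mulr_gt0.
have Zw0 : Z0 <= w0 by clear -ZC JC w0_lo; lia.
have y_gt0 : 0 < y by exact: lt_le_trans y0y.
by apply: (mf y0 y w0 y0_gt0 y_gt0 Zw0 Ew0); rewrite colw0 ?coly0 ?coly.
Qed.

(** * Thresholds and the choice of a block *)

Lemma window_le (p : {poly int}) (M : int) (D k : nat) :
  (0 < k <= D)%N -> (size p <= D.+1)%N -> 0 < p`_D -> 0 < M -> window p M D k.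
Proof.
move=> + sp pD M_gt0; elim: k => [//|[|k] IHk] /andP[_ kD].
  exact: window1.
by apply: windowS => //; apply: IHk; apply: ltnW.
Qed.

Lemma horner_eventually_dominates (p q : {poly int}) (D : nat) (c : int) :
  (size p <= D.+1)%N -> 0 < p`_D -> 0 < c -> (size q <= D)%N ->
  exists T : int, forall z : int, T <= z -> q.[z] < c * p.[z].
Proof.
move=> sp pD c_gt0 sq.
have [||T hT] := @horner_eventually_gt0 (c *: p - q) D.
- rewrite (leq_trans (size_polyD _ _)) // size_polyN geq_max.
  by rewrite (leq_trans (size_scale_leq _ _)) //= ltnW.
- by rewrite coefB coefZ (nth_default _ sq) subr0 mulr_gt0.
by exists T => z /hT; rewrite hornerD hornerN hornerZ subr_gt0.
Qed.

(** The growth condition makes [p.[z] / (a + b)] at least [z], so the diagonal solution stays in the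
    range where a colour is assumed missing. *)
Lemma mono_free_both_colours (a b Z0 T : int) (p : {poly int}) (col : int -> bool) :
  mono_free a b p Z0 col -> 0 < a -> 0 < b -> p`_0 = 0 ->
  (forall z : int, T <= z -> (a + b) * z <= p.[z]) ->
  forall (r : bool) (N : nat), exists2 u : nat,
    (N <= u)%N & col (a * b * (a + b) * u%:Z) = r.
Proof.
move=> mf a0 b0 p0 big r N; set M := a * b * (a + b).
have ab0 : 0 < a + b by exact: addr_gt0.
have M0 : 0 < M by rewrite !mulr_gt0.
apply: contrapT => nex.
have colr (u : nat) : (N <= u)%N -> col (M * u%:Z) = ~~ r.
  move=> Nu; apply: contrapT => ne; apply: nex; exists u => //.
  by move: ne; case: (col _); case: (r).
have M1 : 1 <= M by exact: M0.
have ab1 : 1 <= a + b by exact: ab0.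
pose K : nat := (N + `|T| + `|Z0| + 1)%N.
(* A multiple of [M * (a + b)], so that [p.[z] / (a + b)] is a multiple of [M]. *)
pose z : int := M * ((a + b) * K%:Z).
have z_ge : K%:Z <= z.
  by rewrite /z mulrA ler_peMl // -[1]mulr1 ler_pM.
have Tz : T <= z by clear -z_ge; lia.
have Zz : Z0 <= z by clear -z_ge; lia.
have z0 : 0 < z by clear -z_ge; lia.
have Mz : (M * (a + b) %| z)%Z by rewrite /z mulrA dvdz_mulr.
have [k Ek] := dvdzP (dvdz_horner p _ _ p0 Mz).
have pz : p.[z] = (a + b) * (M * k) by rewrite Ek; ring.
have xz : z <= M * k by rewrite -(ler_pM2l ab0) -pz; exact: big.
have kN : N%:Z <= k.
  have : (a + b) * K%:Z <= k by rewrite -(ler_pM2l M0).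
  apply: le_trans; apply: (@le_trans _ _ K%:Z); first by rewrite /K; lia.
  by rewrite ler_peMl.
have x0 : 0 < M * k by exact: lt_le_trans xz.
have colx : col (M * k) = ~~ r.
  have -> : k = `|k|%N%:Z by clear -kN; lia.
  by apply: colr; clear -kN; lia.
have colz : col z = ~~ r.
  have -> : z = M * `|((a + b) * K%:Z)%R|%N%:Z by rewrite /z gez0_abs // mulr_ge0 // ltW.
  apply: colr; have : K%:Z <= (a + b) * K%:Z by rewrite ler_peMl.
  by rewrite /K; lia.
by apply: (mf (M * k) (M * k) z x0 x0 Zz); rewrite ?colx ?colz // pz; ring.
Qed.

Lemma mono_free_false (a b Z0 : int) (D : nat) (p : {poly int}) (col : int -> bool) :
  0 < a -> 0 < b -> (2 <= D)%N -> (size p <= D.+1)%N -> p`_0 = 0 -> 0 < p`_D ->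
  ~ mono_free a b p Z0 col.
Proof.
move=> a0 b0 D2 sp p0 pD mf.
have D0 : (0 < D)%N by exact: ltnW.
have ab0 : 0 < a + b by exact: addr_gt0.
pose M : int := a * b * (a + b).
have M0 : 0 < M by rewrite !mulr_gt0.
have M'0 : 0 < M * (a + b) by rewrite mulr_gt0.
(* [k = D] makes the gap constant, and [m = 2] matches [long_block]. *)
have [|G [J [T1 [sG win]]]] := @window_le p (M * (a + b)) D D _ sp pD M'0 2 isT.
  by rewrite D0 leqnn.
pose g : int := `|G`_0|.
have Gg z : G.[z] <= g.
  by rewrite subnn in sG; rewrite (size1_polyC sG) hornerC ler_norm.
have g0 : 0 <= g by exact: normr_ge0.
pose J1 : int := Num.max J 1.
have J1_gt0 : 0 < J1 by rewrite lt_max orbT.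
pose h : int := J1 + M * (a + b).
(* Room in a long block for [w0], at most [h] below its end [z], and for [y0], at most [g + 1]
   below. *)
pose C : int := h + g + 1.
have h0 : 0 < h by exact: addr_gt0.
have C0 : 0 < C by rewrite /C; clear -h0 g0; lia.
have snab c : (size (nabla c p) <= D)%N.
  by case: (D) D0 sp => // d _ sp; have [] := @coef_nabla c p d sp.
have szD (q1 q2 : {poly int}) : (size q1 <= D)%N -> (size q2 <= D)%N -> (size (q1 + q2)%R <= D)%N.
  by move=> s1 s2; rewrite (leq_trans (size_polyD _ _)) // geq_max s1.
have szZ c (q : {poly int}) : (size q <= D)%N -> (size (c *: q) <= D)%N.
  by apply: leq_trans; exact: size_scale_leq.
have [T2 mono] := @horner_eventually_mono p D D0 sp pD.
(* Gives the lower bound on [p.[z - h] - (a + b) * (z - 1)] for [long_block]; the linear term has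
   lower degree as [D >= 2]. *)
have [|T3 hT3] := @horner_eventually_dominates p
    (2 *: nabla h p + (2 * (a + b)) *: ('X - 1%:P)) D 1 sp pD isT.
  by apply: (szD); apply: (szZ) => //; rewrite size_XsubC.
(* Gives the smallness condition of [near_switches]: a short block puts [z] within [C + M] of
   [z']. *)
have [|T4 hT4] := @horner_eventually_dominates p
    (b *: nabla (C + M) p + (a + b) *: nabla M p) D b sp pD b0.
  by apply: (szD); exact: szZ.
have [T5 hT5] := @horner_eventually_gt0 p D sp pD.
have [|T6 hT6] := @horner_eventually_dominates p ((a + b) *: 'X) D 1 sp pD isT.
  by apply: (szZ); rewrite size_polyX.
have both := @mono_free_both_colours a b Z0 T6 p col mf a0 b0 p0.
have {}both (r : bool) (N : nat) : exists2 u : nat, (N <= u)%N & col (M * u%:Z) = r.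
  by apply: both => z Tz; have := hT6 z Tz; rewrite hornerZ hornerX mul1r => /ltW.
pose T : int := `|Z0| + `|T1| + `|T2| + `|T3| + `|T4| + `|T5| + C + M + 1.
have M1 : 1 <= M by exact: M0.
have far (n : nat) : (`|T|%N <= n)%N -> T <= M * n%:Z.
  move=> Tn; apply: (@le_trans _ _ n%:Z); first by clear -Tn; lia.
  by rewrite ler_peMl.
have Tbig : [/\ Z0 + C + M < T, T1 + C + M < T, T2 + C + M < T, T3 + C + M < T & T4 < T /\ T5 < T].
  by rewrite /T; clear -C0 M0; split; lia.
have T_gt : C + M < T by rewrite /T; clear -C0 M0; lia.
clearbody T.
(* [s.+1] will be the first false index beyond [u], and [t.+1] the first true one beyond [s.+1], so
   [s], [s.+1], [t], [t.+1] are true, false, false, true. *)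
have [u Tu colu] := both true `|T|%N.
have [s0 us0 cols0] := both false u.+1.
have exs : exists n : nat, (u < n)%N && ~~ col (M * n%:Z).
  by exists s0; rewrite us0 cols0.
case: (ex_minnP exs) => -[//|s] /andP[us /negbTE cols] mins.
have colz : col (M * s%:Z) = true.
  have [<- //|ne_us] := eqVneq u s.
  case Ec: (col _) => //; have := mins s; rewrite Ec andbT ltnn.
  by rewrite ltn_neqAle ne_us -ltnS us => /(_ isT).
have [t0 st0 colt0] := both true s.+2.
have ext : exists n : nat, (s.+1 < n)%N && col (M * n%:Z).
  by exists t0; rewrite st0 colt0.
case: (ex_minnP ext) => -[//|t] /andP[st colt] mint.
have block (n : nat) : (s < n)%N -> (n <= t)%N -> col (M * n%:Z) = false.
  move=> sn nt; have [<- //|ne] := eqVneq s.+1 n.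
  case Ec: (col _) => //; have := mint n; rewrite Ec ltn_neqAle ne sn.
  by move=> /(_ isT); rewrite ltnNge nt.
pose z' : int := M * t.+1%:Z.
have Tz' : T <= z' by apply: far; clear -st us Tu; lia.
have Tz : T <= M * s%:Z by apply: far; clear -us Tu; lia.
have Tw : T <= M * s.+1%:Z by apply: far; clear -us Tu; lia.
have Tw' : T <= M * t%:Z by apply: far; clear -st us Tu; lia.
have Mdvd (x : int) : (M %| (M * x)%R)%Z by rewrite dvdz_mulr.
case: Tbig => TZ TT1 TT2 TT3 [TT4 TT5].
have mono_le (x y : int) : T2 <= x -> x <= y -> p.[x] <= p.[y].
  move=> T2x; rewrite le_eqVlt => /orP[/eqP -> //|xy].
  exact: ltW (mono _ _ T2x xy).
have wz' : M * t%:Z = z' - M by rewrite /z' intS; ring.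
have wz : M * s.+1%:Z = M * s%:Z + M by rewrite intS; ring.
have [long|short] := leP C (z' - M * s.+1%:Z).
  apply: (@long_block a b M C J1 g Z0 p col z' mf a0 b0 erefl p0) => //.
  - exact: Mdvd.
  - by clear -Tz' T_gt M0; lia.
  - by clear -Tz' TZ M0; lia.
  - move=> w /dvdzP[k ->]; rewrite colt /= mulrC => /andP[w1 w2].
    have k1 : s.+1%:Z <= k by rewrite -(ler_pM2l M0); clear -w1 long; lia.
    have k2 : k < t.+1%:Z by rewrite -(ltr_pM2l M0).
    have -> : k = `|k|%N%:Z by clear -k1; lia.
    by apply: block; clear -k1 k2; lia.
  - by rewrite /C /h; clear -g0; lia.
  - by rewrite /C; clear -h0; lia.
  - by move=> x y xC; apply: mono_le; clear -xC Tz' TT2 M0; lia.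
  - have T3z' : T3 <= z' by clear -TT3 Tz' C0 M0; lia.
    have := hT3 z' T3z'; rewrite -/h hornerD !hornerZ horner_nabla hornerXsubC mul1r -mulrA.
    by move: p.[z'] p.[z' - h] ((a + b) * (z' - 1)) => A B E; clear; lia.
  - move=> X hX; have [|Y [rY /andP[Y1 Y2]]] := win z' X _ hX.
      by clear -TT1 Tz' C0 M0; lia.
    exists Y; split; first by apply: reach_le rY; rewrite le_max lexx.
    by rewrite Y1 (le_trans Y2) // lerD2l.
apply: (@near_switches a b M Z0 p col (M * s%:Z) (M * s.+1%:Z) z' (M * t%:Z)
  mf a0 b0 erefl p0) => //.
- exact: Mdvd.
- by clear -TZ Tz C0 M0; lia.
- by clear -TZ Tw C0 M0; lia.
- by clear -TZ Tz' C0 M0; lia.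
- by clear -TZ Tw' C0 M0; lia.
- by rewrite cols colz.
- by rewrite colz.
- by rewrite colz; apply: block; clear -st; lia.
- by apply: hT5; clear -TT5 Tz; lia.
- apply: mono; [by clear -TT2 Tz C0 M0; lia | by rewrite wz ltrDl].
- apply: mono; [by clear -TT2 Tw' C0 M0; lia | by rewrite wz' gtrBl].
- apply: mono_le; [by clear -TT2 Tw C0 M0; lia | rewrite /z' ler_pM2l //; clear -st; lia].
have := hT4 z'; rewrite hornerD !hornerZ !horner_nabla -wz' => H.
have {}H := H (ltW (lt_le_trans TT4 Tz')).
have : b * p.[z' - (C + M)] <= b * p.[M * s%:Z].
  rewrite ler_pM2l //; apply: mono_le; first by clear -TT2 Tz'; lia.
  by clear -short wz; lia.
by apply: lt_le_trans; move: H; rewrite mulrBr -addrA gtrDl addrC subr_lt0.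
Qed.

(** * Transfer to colourings of the positive integers *)

Lemma ord2_eq (i j : 'I_2) : (i == ord0) = (j == ord0) -> i = j.
Proof. by case: i j => [[|[|//]] hi] [[|[|//]] hj] //= _; apply: val_inj. Qed.

Theorem theorem1p1 (a b : nat) (ha : (0 < a)%N) (hb : (0 < b)%N)
    (hab : gcdn a b = 1%N)
    (D : nat) (hD : (2 <= D)%N)
    (p : {poly int}) (hsize : size p = D.+1) (hp0 : p`_0 = 0)
    (hlead : 0 < p`_D) (hp1 : p`_1 != 0) :
  Ramsey 2 (fun x y z : posint =>
    a%:Z * (val x)%:Z + b%:Z * (val y)%:Z = p.[(val z)%:Z]).
Proof.
move=> c fin.
(* The finitely many values of [z] have a maximum, and [Z0] is one more. *)
have := finite_image (fun t : posint * posint * posint => val t.2) fin.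
move=> /finite_seqP[s Es].
(* The default value 1 is taken only at 0, while [mono_free] looks only at positive arguments for
   this [Z0]. *)
pose e (x : int) : posint := insubd (exist _ 1%N isT : posint) `|x|%N.
have eK (x : int) : 0 < x -> (val (e x))%:Z = x.
  by move=> x0; rewrite insubdK; [rewrite gtz0_abs | rewrite /in_mem /=; lia].
pose col x := c (e x) == ord0.
have sp : (size p <= D.+1)%N by rewrite hsize.
apply: (@mono_free_false a b (\max_(i <- s) i).+1%:Z D p col) => // x y z x0 y0 zZ E.
move=> /ord2_eq cxz /ord2_eq cyz.
have z0 : 0 < z by lia.
have : val (e z) \in s.
  suff : [set` s]%classic (val (e z)) by [].
  rewrite -Es; exists (e x, e y, e z) => //=; split; rewrite ?cxz ?cyz //.
  by rewrite !eK.
move=> /(@leq_bigmax_seq _ _ predT id) /(_ isT) le_max.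
have lt_max : (\max_(i <- s) i < val (e z))%N by rewrite -ltz_nat eK.
by rewrite ltnNge le_max in lt_max.
Qed.
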